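(* Let $1\le k<d$ and let $t\ge 1$ be an integer. For every multi-index $\alpha\in\mathbb{N}^d$ with $|\alpha|=t$ there exist an integer $m\ge1$, vectors $y^\alpha_{s,i}\in\mathbb{S}^{d-1}$ and real coefficients $f^\alpha_{s,i}$ ($s=1,\dots,t$, $i=1,\dots,m$) such that $$x^\alpha=\sum_{s=1}^t\sum_{i=1}^m f^\alpha_{s,i}\,\mu^s_{k,d}(E_{x,y^\alpha_{s,i}})\qquad\text{for all }x\in\mathbb{S}^{d-1}.$$
   Context: $\mathscr{H}_d$ denotes the space of real symmetric $d\times d$ matrices with inner product $\langle A,B\rangle=\operatorname{trace}(AB)$. $\mathcal{G}_{k,d}=\{P\in\mathscr{H}_d:P^2=P,\ \operatorname{trace}(P)=k\}$ is the set of rank-$k$ orthogonal projections of $\mathbb{R}^d$, and $\sigma_{k,d}$ is the orthogonally invariant Borel probability measure on $\mathcal{G}_{k,d}$ (invariant under $P\mapsto UPU^*$, $U\in\mathcal{O}(d)$). For $M\in\mathscr{H}_d$, $\mu^s_{k,d}(M):=\int_{\mathcal{G}_{k,d}}\langle P,M\rangle^s\,d\sigma_{k,d}(P)$. For $x,y\in\mathbb{R}^d$, $E_{x,y}:=\tfrac12(xy^*+yx^* )$. For $\alpha\in\mathbb{N}^d$, $x^\alpha=x_1^{\alpha_1}\cdots x_d^{\alpha_d}$ and $|\alpha|=\sum_i\alpha_i$. *)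

(* Defs.v *)
From HB Require Import structures.
From mathcomp Require Import all_boot all_order all_algebra.
From mathcomp Require Import all_classical all_reals all_analysis.
Unset Printing Implicit Defensive.
Import Order.TTheory GRing.Theory Num.Theory.
Import numFieldTopology.Exports numFieldNormedType.Exports.
Local Open Scope classical_set_scope.
Local Open Scope ring_scope.

Definition BorelMx (R : realType) (d : nat) : measurableType _ :=
  g_sigma_algebraType (open : set_system 'M[R]_(d, d)).

(* G_{k,d}: rank-k orthogonal projections = symmetric idempotents of trace k *)
Definition Grass (R : realType) (d k : nat) : set (BorelMx R d) :=
  [set P : 'M[R]_d | P^T = P /\ P *m P = P /\ \tr P = k%:R].

Definition orthogonal_mx (R : realType) (d : nat) (U : 'M[R]_d) : Prop :=
  U *m U^T = 1%:M.

(* sigma is an orthogonally invariant Borel probability measure on G_{k,d}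
   (viewed as a probability on the Borel sets of 'M_d concentrated on G_{k,d}) *)
Definition grass_invariant_prob (R : realType) (d k : nat)
    (sigma : probability (BorelMx R d) R) : Prop :=
  sigma (@Grass R d k) = 1%E /\
  forall U : 'M[R]_d, orthogonal_mx R d U ->
    forall A : set (BorelMx R d), measurable A ->
      sigma ((fun P : BorelMx R d => U *m P *m U^T) @^-1` A) = sigma A.

Definition hsip (R : realType) (d : nat) (A B : 'M[R]_d) : R := \tr (A *m B).

Definition mu_moment (R : realType) (d k : nat) (sigma : probability (BorelMx R d) R)
    (s : nat) (M : 'M[R]_d) : R :=
  Rintegral sigma (@Grass R d k) (fun P : BorelMx R d => (hsip R d P M) ^+ s).

Definition Exy (R : realType) (d : nat) (x y : 'cV[R]_d) : 'M[R]_d :=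
  2^-1 *: (x *m y^T + y *m x^T).

Definition on_sphere (R : realType) (d : nat) (x : 'cV[R]_d) : Prop :=
  \sum_(i < d) (x i 0) ^+ 2 = 1.

Definition monomial (R : realType) (d : nat) (alpha : 'I_d -> nat) (x : 'cV[R]_d) : R :=
  \prod_(i < d) (x i 0) ^+ alpha i.

(* Main.v *)
Require Import Defs.
From HB Require Import structures.
From mathcomp Require Import all_boot all_order all_algebra.
From mathcomp Require Import all_classical all_reals all_analysis measurable_realfun.
From mathcomp Require Import ring lra.
Import Order.TTheory GRing.Theory Num.Theory.
Import numFieldTopology.Exports numFieldNormedType.Exports.
Local Open Scope ring_scope.

(* Only the terms with s = t are needed. With x^{(x)t} the t-fold tensor power,
   mu^t(E_{x,y}) = E <x, P y>^t = <y^{(x)t}, Q x^{(x)t}> where Q = E[P^{(x)t}].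
   Choose finitely many unit vectors y_i whose powers y_i^{(x)t} span all powers
   of unit vectors, and let M be the matrix with these rows. Since x^alpha is a
   coordinate of x^{(x)t}, it is enough that the columns of M lie in the row
   space of the Gram matrix M Q M^T, i.e. that v = M^T u vanishes as soon as
   M Q v = 0. In that case E |P^{(x)t} v|^2 = <v, Q v> = 0, so P^{(x)t} v = 0
   almost surely, and by orthogonal invariance P^{(x)t} U^{(x)t} v = 0 almost
   surely for each orthogonal U. These U^{(x)t} v live in a finite-dimensional
   space, so some rank-k projection P kills all of them at once; moving a unit
   vector fixed by P onto an arbitrary unit y gives <y^{(x)t}, v> = 0. Hence
   M v = 0, and |v|^2 = <u, M v> = 0. *)

(** * Tensor powers of vectors and matrices, in coordinates *)

Section TensorPower.
Context {R : comPzRingType} (t : nat).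

(** One coordinate per word of length [t] in [n] letters: the standard basis of the [t]-fold tensor
    power, enumerated so that ordinary matrix algebra applies. *)
Definition tpow_dim (n : nat) : nat := #|{: {ffun 'I_t -> 'I_n}}|.

Definition tpow_index {n : nat} (i : 'I_(tpow_dim n)) : {ffun 'I_t -> 'I_n} :=
  enum_val i.

Definition tpow_vec {n : nat} (x : 'cV[R]_n) : 'cV[R]_(tpow_dim n) :=
  \col_i \prod_(j < t) x (tpow_index i j) 0.

Definition tpow_mx {m n : nat} (A : 'M[R]_(m, n)) :
    'M[R]_(tpow_dim m, tpow_dim n) :=
  \matrix_(i, k) \prod_(j < t) A (tpow_index i j) (tpow_index k j).

(** Distributivity: expanding the product picks one summand per factor, that is, a word. All
    multiplicativity of tensor powers rests on this. *)
Lemma sum_tpow {n : nat} (F : 'I_t -> 'I_n -> R) :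
  \sum_(k < tpow_dim n) \prod_(j < t) F j (tpow_index k j) =
  \prod_(j < t) \sum_(l < n) F j l.
Proof.
rewrite bigA_distr_bigA /= (reindex (@enum_val {ffun 'I_t -> 'I_n} predT)) /=.
  exact/esym/eq_bigl.
exists (@enum_rank _) => f _; first exact: enum_valK.
exact: enum_rankK.
Qed.

Lemma tpow_mulmx_vec {m n : nat} (A : 'M[R]_(m, n)) (x : 'cV[R]_n) :
  tpow_vec (A *m x) = tpow_mx A *m tpow_vec x.
Proof.
apply/matrixP => i j; rewrite !mxE (ord1 j).
under [RHS]eq_bigr => k _ do rewrite !mxE -big_split /=.
rewrite (sum_tpow (fun j l => A (tpow_index i j) l * x l 0)).
by apply: eq_bigr => l _; rewrite mxE.
Qed.

Lemma tpow_mulmx {m n p : nat} (A : 'M[R]_(m, n)) (B : 'M[R]_(n, p)) :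
  tpow_mx (A *m B) = tpow_mx A *m tpow_mx B.
Proof.
apply/matrixP => i k; rewrite !mxE.
under [RHS]eq_bigr => l _ do rewrite !mxE -big_split /=.
rewrite (sum_tpow (fun j l => A (tpow_index i j) l * B l (tpow_index k j))).
by apply: eq_bigr => l _; rewrite mxE.
Qed.

Lemma tpow_trmx {m n : nat} (A : 'M[R]_(m, n)) : tpow_mx A^T = (tpow_mx A)^T.
Proof. by apply/matrixP => i k; rewrite !mxE; apply: eq_bigr => j _; rewrite mxE. Qed.

Lemma dot_tpow_vec {n : nat} (x y : 'cV[R]_n) :
  ((tpow_vec x)^T *m tpow_vec y) 0 0 = (x^T *m y) 0 0 ^+ t.
Proof.
rewrite !mxE; under eq_bigr => k _ do rewrite !mxE -big_split /=.
rewrite (sum_tpow (fun j l => x l 0 * y l 0)) prodr_const card_ord.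
by congr (_ ^+ t); apply: eq_bigr => l _; rewrite mxE.
Qed.

Lemma tpow_mx1 {n : nat} : tpow_mx (1%:M : 'M[R]_n) = 1%:M.
Proof.
apply/matrixP => i k; rewrite !mxE.
case: (eqVneq i k) => [->|ik].
  by rewrite big1 // => j _; rewrite mxE eqxx.
case: (pickP (fun j => tpow_index i j != tpow_index k j)) => [j jP|eq_ik].
  by rewrite (bigD1 j) //= mxE (negbTE jP) mul0r.
case/eqP: ik; apply/enum_val_inj/ffunP => j; exact/eqP/negbFE/eq_ik.
Qed.

End TensorPower.

(** The word that repeats each letter [i] exactly [alpha i] times has length [t]; the coordinate it
    indexes is the monomial. *)
Lemma monomial_tpow_vec {R : realType} {d : nat} (alpha : 'I_d -> nat) (t : nat) :
  (\sum_(i < d) alpha i)%N = t ->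
  exists i : 'I_(tpow_dim t d), forall x, monomial R d alpha x = tpow_vec t x i 0.
Proof.
move=> sumt; pose s := flatten [seq nseq (alpha i) i | i <- enum 'I_d].
have sz : size s == t.
  rewrite size_flatten /shape -map_comp sumnE big_map -sumt big_enum /=.
  by apply/eqP/eq_bigr => i _; rewrite size_nseq.
exists (enum_rank [ffun j => tnth (Tuple sz) j]) => x.
rewrite mxE /tpow_index enum_rankK; under [RHS]eq_bigr => j _ do rewrite ffunE.
rewrite -(big_tuple _ _ (Tuple sz) xpredT (fun l => x l 0)) /= big_flatten big_map.
rewrite /monomial big_enum /=; apply: eq_bigr => i _.
by rewrite big_nseq -Monoid.iteropE.
Qed.

(** Choose rows from [A] of maximal rank: adjoining another element of [A] cannot raise the rank, so
    it already lies in the row space. The member [a0] provides a first such matrix. *)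
Lemma finite_row_span {F : fieldType} {n : nat} (A : set 'rV[F]_n) (a0 : 'rV[F]_n) :
  A a0 -> exists m, exists2 M : 'M[F]_(m.+1, n),
    forall i, A (row i M) & forall a, A a -> (a <= M)%MS.
Proof.
move=> A0; pose spans r := `[< exists m, exists2 M : 'M[F]_(m.+1, n),
  forall i, A (row i M) & \rank M = r >].
have ex : exists r, spans r.
  exists (\rank a0); apply/asboolP; exists 0%N, a0 => // i.
  by rewrite (_ : row i a0 = a0) //; apply/rowP => j; rewrite mxE ord1.
have bound r : spans r -> (r <= n)%N.
  by move=> /asboolP[m [M _ <-]]; exact: rank_leq_col.
case: (ex_maxnP ex bound) => r /asboolP[m [M MA rkM]] maxr.
exists m, M => // a Aa.
have rowA (i : 'I_(1 + m.+1)) : A (row i (col_mx a M)).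
  case: (split_ordP i) => j ->; last by rewrite rowKd.
  by rewrite rowKu (_ : row j a = a) //; apply/rowP => l; rewrite mxE ord1.
have : spans (\rank (col_mx a M)) by apply/asboolP; exists m.+1, (col_mx a M).
move=> /maxr le; have := mxrank_leqif_sup (addsmxSr a M).
by move=> /geq_leqif; rewrite addsmx_sub addsmxE rkM le => /esym /andP[].
Qed.

(** * Unit vectors and transitivity of the orthogonal group on the sphere *)

Section Sphere.
Context {R : realType} {d : nat}.
Implicit Types x y w : 'cV[R]_d.

Lemma on_sphereE x : on_sphere R d x <-> (x^T *m x) 0 0 = 1.
Proof.
rewrite /on_sphere mxE; split=> <-; apply: eq_bigr => i _;
  by rewrite mxE expr2.
Qed.

Lemma sqnorm_eq0 {n} (x : 'cV[R]_n) : (x^T *m x) 0 0 = 0 -> x = 0.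
Proof.
rewrite mxE; under eq_bigr => i _ do rewrite mxE -expr2.
move=> /eqP; rewrite psumr_eq0 => [/allP x0|i _]; last exact: sqr_ge0.
apply/colP => i; rewrite mxE; apply/eqP; rewrite -sqrf_eq0.
exact: (implyP (x0 i (mem_index_enum _))).
Qed.

Lemma orthogonal_transitive {y w} : on_sphere R d y -> on_sphere R d w ->
  exists2 U, orthogonal_mx R d U & U *m y = w.
Proof.
move=> /on_sphereE y1 /on_sphereE w1.
case: (eqVneq y w) => [->|yw].
  by exists 1%:M; rewrite /orthogonal_mx ?trmx1 ?mul1mx.
pose z := y - w; pose q := (z^T *m z) 0 0.
have q0 : q != 0.
  by apply: contra yw => /eqP/sqnorm_eq0/eqP; rewrite subr_eq0.
have zz : z^T *m z = q%:M by rewrite [LHS]mx11_scalar.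
have dotC (a b : 'cV[R]_d) : (a^T *m b) 0 0 = (b^T *m a) 0 0.
  by rewrite -[RHS]trace_mx11 -mxtrace_tr trmx_mul trmxK trace_mx11.
have sub00 (A B : 'M[R]_1) : (A - B) 0 0 = A 0 0 - B 0 0 by rewrite !mxE.
(* For unit vectors, |y - w|^2 = 2 - 2<y,w> is twice <y - w, y>, so the reflection subtracts exactly
   [z] from [y]. *)
have zy : z^T *m y = (q / 2)%:M.
  rewrite [LHS]mx11_scalar; congr (_%:M).
  rewrite /q /z linearB /= !mulmxBl !mulmxBr !sub00 y1 w1 (dotC y w).
  by field.
(* The Householder reflection in [y - w]. *)
pose U := 1%:M - (2 / q) *: (z *m z^T).
have UT : U^T = U by rewrite linearB linearZ /= trmx1 trmx_mul trmxK.
exists U.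
  rewrite /orthogonal_mx UT /U.
  have : (z *m z^T) *m (z *m z^T) = q *: (z *m z^T).
    by rewrite mulmxA -(mulmxA z) zz mul_mx_scalar scalemxAl.
  move: (z *m z^T) => Z ZZ.
  rewrite mulmxBl mul1mx -scalemxAl mulmxBr mulmx1 -scalemxAr ZZ.
  apply/matrixP => i j; rewrite !mxE.
  by field.
rewrite mulmxBl mul1mx -scalemxAl -mulmxA zy mul_mx_scalar scalerA.
rewrite (_ : 2 / q * (q / 2) = 1); last by field.
by rewrite scale1r /z opprB addrC subrK.
Qed.

End Sphere.

(** * Borel measurability of matrix functions and of the Grassmannian *)

Section BorelMatrices.
Context {R : realType} {d : nat}.

Definition measurable_mx {m n : nat} (F : BorelMx R d -> 'M[R]_(m, n)) : Prop :=
  forall i j, measurable_fun setT (fun P => F P i j).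

Lemma measurable_mx_id : measurable_mx (fun P => P : 'M[R]_d).
Proof.
move=> i j; apply: (measurability _ (RGenOpens.measurableE R)).
move=> _ [_ [a [b ->]] <-]; rewrite setTI; apply: sub_sigma_algebra.
exact: (proj1 (continuousP _) (@coord_continuous R d d i j) _ (interval_open _ _)).
Qed.

Lemma measurable_mx_cst {m n : nat} (A : 'M[R]_(m, n)) : measurable_mx (fun=> A).
Proof. by move=> i j; exact: measurable_cst. Qed.

Lemma measurable_mxB {m n : nat} (F G : BorelMx R d -> 'M[R]_(m, n)) :
  measurable_mx F -> measurable_mx G -> measurable_mx (fun P => F P - G P).
Proof.
move=> mF mG i j; under eq_fun => P do rewrite !mxE.
exact: measurable_funB.
Qed.

Lemma measurable_mx_mul {m n p : nat} (F : BorelMx R d -> 'M[R]_(m, n))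
    (G : BorelMx R d -> 'M[R]_(n, p)) :
  measurable_mx F -> measurable_mx G -> measurable_mx (fun P => F P *m G P).
Proof.
move=> mF mG i j; under eq_fun => P do rewrite mxE.
by apply: measurable_sum => l; exact: measurable_funM.
Qed.

Lemma measurable_mx_tpow (t m n : nat) (F : BorelMx R d -> 'M[R]_(m, n)) :
  measurable_mx F -> measurable_mx (fun P => tpow_mx t (F P)).
Proof.
move=> mF i j; under eq_fun => P do rewrite mxE.
by apply: measurable_prod => l _; exact: mF.
Qed.

Lemma measurable_mx_eq0 {m n : nat} (F : BorelMx R d -> 'M[R]_(m, n)) :
  measurable_mx F -> measurable [set P | F P = 0]%classic.
Proof.
(* A real matrix vanishes iff the sum of its squared entries does, which leaves one real function to
   handle. *)
move=> mF; pose g P := \sum_i \sum_j (F P i j) ^+ 2.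
have mg : measurable_fun setT g.
  apply: measurable_sum => i; apply: measurable_sum => j.
  exact: measurable_funX.
rewrite (_ : mkset _ = setT `&` g @^-1` [set 0])%classic; first exact: mg.
rewrite setTI; apply/seteqP; split=> P; rewrite /g /=.
  by move=> ->; rewrite big1 // => i _; rewrite big1 // => j _; rewrite mxE expr0n.
move=> /eqP; rewrite psumr_eq0 => [/allP sum0|i _]; last first.
  by apply: sumr_ge0 => j _; exact: sqr_ge0.
apply/matrixP => i j; rewrite mxE; apply/eqP; rewrite -sqrf_eq0.
have := implyP (sum0 i (mem_index_enum _)) isT.
rewrite psumr_eq0 => [/allP row0|l _]; last exact: sqr_ge0.
exact: (implyP (row0 j (mem_index_enum _)) isT).
Qed.

Lemma measurable_Grass (k : nat) : measurable (Grass R d k).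
Proof.
have mid := measurable_mx_id.
rewrite (_ : Grass R d k = [set P : BorelMx R d | (P : 'M[R]_d)^T - P = 0] `&`
  ([set P : BorelMx R d | (P : 'M[R]_d) *m P - P = 0] `&`
  [set P : BorelMx R d | (\tr (P : 'M[R]_d) - k%:R)%:M = 0 :> 'M[R]_1]))%classic.
  apply: measurableI; last apply: measurableI; apply: measurable_mx_eq0.
  - apply: (measurable_mxB _ _ _ mid) => i j.
    under eq_fun => P do rewrite mxE.
    exact: mid.
  - exact: measurable_mxB _ _ (measurable_mx_mul _ _ mid mid) mid.
  - move=> i j; rewrite !ord1; under eq_fun => P do rewrite mxE eqxx mulr1n.
    apply: measurable_funB; last exact: measurable_cst.
    by apply: measurable_sum => l; exact: mid.
apply/seteqP; split=> P /=.
  by move=> [-> [-> ->]]; rewrite !subrr raddf0.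
move=> [/subr0_eq PT [/subr0_eq PP /matrixP/(_ 0 0)]].
by rewrite !mxE eqxx mulr1n => /subr0_eq.
Qed.

(** By symmetry and idempotence [P l l] is the squared norm of row [l]. So it dominates its own
    square, hence is at most 1, and it bounds the square of each entry of that row. *)
Lemma Grass_entry_le1 (k : nat) (P : 'M[R]_d) i j : Grass R d k P -> `|P i j| <= 1.
Proof.
move=> [PT [PP _]].
have sumP l : P l l = \sum_m (P l m) ^+ 2.
  rewrite -[in LHS]PP mxE; apply: eq_bigr => m _.
  by rewrite -{2}PT mxE expr2.
have Pll l : P l l <= 1.
  have : (P l l) ^+ 2 <= P l l.
    by rewrite {2}sumP (bigD1 l) //= lerDl sumr_ge0 // => m _; exact: sqr_ge0.
  by nra.
rewrite -(@expr_le1 _ 2) // real_normK ?num_real //; apply: le_trans (Pll i).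
by rewrite sumP (bigD1 j) //= lerDl sumr_ge0 // => m _; exact: sqr_ge0.
Qed.

End BorelMatrices.

(** * Integrals of finite linear combinations *)

Section RintegralLinearCombination.
Context {disp : measure_display} {T : measurableType disp} {R : realType}.
Context {mu : measure T R} {D : set T} (mD : measurable D).

Lemma integrable_lincomb {I : Type} (s : seq I) (c : I -> R) (f : I -> T -> R) :
  (forall i, mu.-integrable D (EFin \o f i)) ->
  mu.-integrable D (EFin \o (fun x => \sum_(i <- s) c i * f i x)).
Proof.
move=> fi; rewrite (_ : _ \o _ =
    fun x => (\sum_(i <- s) (c i)%:E * (EFin \o f i) x)%E).
  by apply: integrable_sum => // i _; exact: integrableZl.
by apply/funext => x; rewrite /= -sumEFin.
Qed.

Lemma Rintegral_lincomb {I : Type} (s : seq I) (c : I -> R) (f : I -> T -> R) :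
  (forall i, mu.-integrable D (EFin \o f i)) ->
  Rintegral mu D (fun x => \sum_(i <- s) c i * f i x) =
  \sum_(i <- s) c i * Rintegral mu D (f i).
Proof.
move=> fi; elim: s => [|i s IHs].
  rewrite big_nil -[RHS](Rintegral_set0 mu (fun=> 0)) /Rintegral.
  rewrite integral_set0 integral0_eq // => x _.
  by rewrite big_nil.
rewrite big_cons -IHs -RintegralZl // -RintegralD //; last 2 first.
- by have := integrable_lincomb [:: i] c f fi; under eq_fun do rewrite /= big_seq1.
- exact: integrable_lincomb.
by apply: eq_Rintegral => x _; rewrite big_cons.
Qed.

End RintegralLinearCombination.

(** * Moments as bilinear forms of the mean tensor power *)

Section Moments.
Context {R : realType} {d k : nat} (t : nat) {sigma : probability (BorelMx R d) R}.
Context (sigmaP : grass_invariant_prob R d k sigma).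

Local Notation G := (Grass R d k).

Lemma Grass_ae : {ae sigma, forall P, G P}.
Proof.
have mG : measurable G := measurable_Grass k.
exists (~` G)%classic; split; [exact: measurableC| |by []].
rewrite -[LHS]/(sigma (~` G)%classic) probability_setC //.
by rewrite [X in (1 - X)%E](_ : _ = 1%E) ?subee //; exact: sigmaP.1.
Qed.

Definition tpow_mean : 'M[R]_(tpow_dim t d) :=
  \matrix_(i, j) Rintegral sigma G (fun P : BorelMx R d => tpow_mx t (P : 'M[R]_d) i j).

Lemma integrable_tpow i j :
  sigma.-integrable G (EFin \o (fun P : BorelMx R d => tpow_mx t (P : 'M[R]_d) i j)).
Proof.
apply: measurable_bounded_integrable.
- exact: measurable_Grass.
- by rewrite [X in (X < _)%E](_ : _ = 1%E) ?ltry //; exact: sigmaP.1.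
- apply: measurable_funTS; exact: (measurable_mx_tpow t d d _ measurable_mx_id).
exists 1; split; first exact: num_real.
move=> x x1 P GP /=; apply: le_trans (ltW x1).
rewrite mxE normr_prod.
apply: le_trans (_ : \prod_(l < t) 1 <= 1); last by rewrite big1.
by apply: ler_prod => l _; rewrite normr_ge0 (Grass_entry_le1 _ _ _ _ GP).
Qed.

Lemma tpow_formE (a b : 'cV[R]_(tpow_dim t d)) (M : 'M[R]_(tpow_dim t d)) :
  (a^T *m M *m b) 0 0 = \sum_j b j 0 * \sum_i a i 0 * M i j.
Proof.
rewrite mxE; apply: eq_bigr => j _; rewrite mulrC mxE.
by congr (_ * _); apply: eq_bigr => i _; rewrite mxE.
Qed.

Lemma integrable_tpow_form (a b : 'cV[R]_(tpow_dim t d)) :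
  sigma.-integrable G (EFin \o (fun P : BorelMx R d =>
    (a^T *m tpow_mx t (P : 'M[R]_d) *m b) 0 0)).
Proof.
have mG : measurable G := measurable_Grass k.
under eq_fun => P do rewrite /= tpow_formE.
do 2![apply: integrable_lincomb => // ?]; exact: integrable_tpow.
Qed.

Lemma Rintegral_tpow_form (a b : 'cV[R]_(tpow_dim t d)) :
  Rintegral sigma G (fun P : BorelMx R d => (a^T *m tpow_mx t (P : 'M[R]_d) *m b) 0 0) =
  (a^T *m tpow_mean *m b) 0 0.
Proof.
have mG : measurable G := measurable_Grass k.
rewrite tpow_formE; under eq_fun => P do rewrite tpow_formE.
rewrite Rintegral_lincomb //; last first.
  by move=> j; apply: integrable_lincomb => // i; exact: integrable_tpow.
apply: eq_bigr => j _; rewrite Rintegral_lincomb //; last first.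
  by move=> i; exact: integrable_tpow.
by congr (_ * _); apply: eq_bigr => i _; rewrite [tpow_mean _ _]mxE.
Qed.

(** Symmetry of [P] gives <P, E_{x,y}> = <y, P x>, whose [t]-th power is the pairing of the tensor
    powers; then integrate. *)
Lemma mu_momentE (x y : 'cV[R]_d) :
  mu_moment R d k sigma t (Exy R d x y) =
  ((tpow_vec t y)^T *m tpow_mean *m tpow_vec t x) 0 0.
Proof.
rewrite -Rintegral_tpow_form; apply: eq_Rintegral => P; rewrite inE => -[PT _].
rewrite -mulmxA -tpow_mulmx_vec dot_tpow_vec; congr (_ ^+ t).
have trE (u w : 'cV[R]_d) : \tr (P *m (u *m w^T)) = (w^T *m (P *m u)) 0 0.
  by rewrite mulmxA mxtrace_mulC trace_mx11.
have symP : (x^T *m (P *m y)) 0 0 = (y^T *m (P *m x)) 0 0.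
  by rewrite -trace_mx11 -mxtrace_tr !trmx_mul trmxK PT trace_mx11 mulmxA.
rewrite /hsip /Exy -scalemxAr linearZ /= mulmxDr linearD /= !trE symP.
by field.
Qed.

(* [v^T E[P^{(x)t}] v = E |P^{(x)t} v|^2], since [P^T P = P]. *)
Lemma tpow_mean_null (v : 'cV[R]_(tpow_dim t d)) :
  (v^T *m tpow_mean *m v) 0 0 = 0 ->
  {ae sigma, forall P : BorelMx R d, tpow_mx t (P : 'M[R]_d) *m v = 0}.
Proof.
move=> v0; have mG : measurable G := measurable_Grass k.
pose q (P : BorelMx R d) := (v^T *m tpow_mx t (P : 'M[R]_d) *m v) 0 0.
have qE P : G P -> q P = ((tpow_mx t (P : 'M[R]_d) *m v)^T *m
    (tpow_mx t (P : 'M[R]_d) *m v)) 0 0.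
  move=> [PT [PP _]]; rewrite trmx_mul -tpow_trmx PT -!mulmxA.
  by rewrite (mulmxA (tpow_mx t _)) -tpow_mulmx PP mulmxA.
have q_ge0 P : G P -> 0 <= q P.
  move=> /qE ->; rewrite mxE; apply: sumr_ge0 => i _.
  by rewrite [X in X * _]mxE -expr2 sqr_ge0.
have mq : measurable_fun G (EFin \o q).
  apply/measurable_EFinP/measurable_funTS.
  apply: (measurable_mx_mul (fun P => v^T *m tpow_mx t (P : 'M[R]_d)) (fun=> v)).
    apply: (measurable_mx_mul (fun=> v^T)); first exact: measurable_mx_cst.
    exact: (measurable_mx_tpow t d d _ measurable_mx_id).
  exact: measurable_mx_cst.
have int0 : (\int[sigma]_(P in G) `|(EFin \o q) P| = 0)%E.
  rewrite (eq_integral (EFin \o q)); last first.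
    by move=> P; rewrite inE => GP; rewrite /= ger0_norm // q_ge0.
  (* The integral is finite, so the real-valued formula transfers to the extended reals. *)
  rewrite -[LHS]fineK; last exact/integrable_fin_num/integrable_tpow_form.
  by congr _%:E; rewrite -[RHS]v0 -Rintegral_tpow_form.
have G1 := Grass_ae.
have := (ae_eq_integral_abs sigma mG mq).1 int0.
move=> q0; near=> P.
have GP : G P by near: P.
apply/sqnorm_eq0; rewrite -qE //.
have : ((EFin \o q) P = 0)%E.
  by move: GP; near: P.
by move=> [].
Unshelve. all: by end_near.
Qed.

End Moments.

(** * Tensors annihilated by almost every projection *)

Section NullVectors.
Context {R : realType} {d k : nat} (t : nat) {sigma : probability (BorelMx R d) R}.
Context (sigmaP : grass_invariant_prob R d k sigma) (k_gt0 : (1 <= k)%N).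

Let ae_null (v : 'cV[R]_(tpow_dim t d)) : Prop :=
  {ae sigma, forall P : BorelMx R d, tpow_mx t (P : 'M[R]_d) *m v = 0}.

(** As the tensor power of [U] is invertible, [P] kills the rotated tensor iff U^T P U kills [v],
    and U^T P U has the same law as [P]. *)
Lemma ae_null_orthogonal (U : 'M[R]_d) v :
  orthogonal_mx R d U -> ae_null v -> ae_null (tpow_mx t U *m v).
Proof.
move=> UUT [N [mN N0 subN]].
pose B (w : 'cV[R]_(tpow_dim t d)) :=
  [set P : BorelMx R d | tpow_mx t (P : 'M[R]_d) *m w = 0]%classic.
have mB w : measurable (B w).
  apply: (measurable_mx_eq0 (fun P => tpow_mx t (P : 'M[R]_d) *m w)).
  apply: measurable_mx_mul; last exact: measurable_mx_cst.
  exact: (measurable_mx_tpow t d d _ measurable_mx_id).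
have UTU : U^T *m U = 1%:M by exact: mulmx1C.
have mBC w : measurable (~` B w)%classic by exact: measurableC.
have preB : B (tpow_mx t U *m v) =
    ((fun P : BorelMx R d => U^T *m P *m (U^T)^T) @^-1` B v)%classic.
  apply/seteqP; split=> P; rewrite /B /= trmxK !tpow_mulmx -!mulmxA.
    by move=> ->; rewrite mulmx0.
  move=> /(congr1 (mulmx (tpow_mx t U))).
  by rewrite mulmx0 mulmxA -tpow_mulmx UUT tpow_mx1 mul1mx.
exists (~` B (tpow_mx t U *m v))%classic; split => //.
rewrite preB preimage_setC sigmaP.2 //; last by rewrite /orthogonal_mx trmxK.
apply/eqP; rewrite eq_le measure_ge0 andbT -N0; apply: le_measure.
- by rewrite inE.
- by rewrite inE.
- exact: subN.
Qed.

(** Trace k >= 1 forces a nonzero column, which idempotence makes a fixed vector; normalize it. *)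
Lemma Grass_unit_fixed (P : 'M[R]_d) : Grass R d k P ->
  exists2 w, on_sphere R d w & P *m w = w.
Proof.
move=> [_ [PP trP]].
have [j Pj0] : exists j, col j P != 0.
  apply/existsP; apply: contraT; rewrite negb_exists => /forallP P0.
  have : P = 0.
    apply/matrixP => i j; have /negPn/eqP/colP/(_ i) := P0 j.
    by rewrite !mxE.
  move=> P_0; move/eqP: trP; rewrite P_0 mxtrace0 eq_sym pnatr_eq0.
  by rewrite -leqn0 leqNgt k_gt0.
set c := col j P in Pj0; pose q := (c^T *m c) 0 0.
have q_gt0 : 0 < q.
  rewrite lt_neqAle eq_sym; apply/andP; split.
    by apply: contra Pj0 => /eqP/sqnorm_eq0 ->.
  by rewrite /q mxE sumr_ge0 // => i _; rewrite mxE -expr2 sqr_ge0.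
exists ((Num.sqrt q)^-1 *: c); last first.
  by rewrite -scalemxAr /c colE mulmxA PP.
apply/on_sphereE; rewrite [(_ *: c)^T]linearZ /= -scalemxAl -scalemxAr scalerA mxE.
by rewrite -/q -invfM -expr2 sqr_sqrtr ?ltW // mulVf ?gt_eqF.
Qed.

Lemma ae_null_dot v (y : 'cV[R]_d) :
  ae_null v -> on_sphere R d y -> (tpow_vec t y)^T *m v = 0.
Proof.
move=> nv y1.
have null0 : ae_null (0 : 'rV[R]_(tpow_dim t d))^T.
  by apply: aeW => P; rewrite trmx0 mulmx0.
(* One projection [P] annihilates the whole space of a.e. null vectors. *)
have [m [M nM spanM]] := finite_row_span (fun a => ae_null a^T) 0 null0.
(* Finitely many almost sure conditions hold together almost surely, and an event of probability 1
   is nonempty. *)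
have [P [GP PM]] : exists P : BorelMx R d, Grass R d k P /\
    forall i, tpow_mx t (P : 'M[R]_d) *m (row i M)^T = 0.
  apply: (@filter_ex _ _ (ae_properfilter_algebraOfSetsType _ (mu := sigma))).
    by rewrite [X in (_ < X)%E](_ : _ = 1%E) ?lte01 //; exact: probability_setT.
  apply: filterI (Grass_ae sigmaP) _.
  apply: (@filter_forall (BorelMx R d) _ (fun i (P : BorelMx R d) =>
    tpow_mx t (P : 'M[R]_d) *m (row i M)^T = 0)
    _ (ae_filter_ringOfSetsType sigma)) => i; exact: nM.
have Pnull w : ae_null w -> tpow_mx t (P : 'M[R]_d) *m w = 0.
  move=> nw; have /submxP[D wD] : (w^T <= M)%MS by apply: spanM; rewrite trmxK.
  apply: trmx_inj; rewrite trmx_mul wD trmx0 -mulmxA.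
  suff -> : M *m (tpow_mx t (P : 'M[R]_d))^T = 0 by rewrite mulmx0.
  apply/row_matrixP => i; rewrite row_mul row0.
  by apply: trmx_inj; rewrite trmx_mul trmxK PM trmx0.
have [w w1 Pw] := Grass_unit_fixed P GP.
have [U UUT Uy] := orthogonal_transitive y1 w1.
(* Move [U] across the pairing, then insert [P] next to its fixed vector [w]: what remains is [P]
   applied to the rotated [v], which is again null. *)
have -> : y = U^T *m w by rewrite -Uy mulmxA (mulmx1C UUT) mul1mx.
rewrite tpow_mulmx_vec trmx_mul tpow_trmx trmxK -mulmxA -Pw tpow_mulmx_vec.
rewrite trmx_mul -tpow_trmx GP.1 -mulmxA.
by rewrite Pnull ?mulmx0 //; exact: ae_null_orthogonal.
Qed.

End NullVectors.

(** * The Gram matrix criterion and the final expansion *)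

Lemma mulmx_gram_sub {F : fieldType} {m n : nat} (M : 'M[F]_(m, n)) (Q : 'M[F]_n) :
  (forall u : 'cV[F]_m, M *m Q *m M^T *m u = 0 -> M^T *m u = 0) ->
  (M^T <= M *m Q *m M^T)%MS.
Proof.
(* Row-space inclusion is tested on the cokernel matrix, whose columns are killed by the Gram matrix
   and hence by [M^T]. *)
move=> ker0; rewrite submxE; apply/eqP/matrixP => i j.
have /ker0 : M *m Q *m M^T *m col j (cokermx (M *m Q *m M^T)) = 0.
  by rewrite colE mulmxA mulmx_coker mul0mx.
by rewrite colE mulmxA -colE => /colP/(_ i); rewrite !mxE.
Qed.

Theorem theorem2p1 (R : realType) (d k t : nat)
  (sigma : probability (BorelMx R d) R) :
  (1 <= k)%N -> (k < d)%N -> (1 <= t)%N ->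
  grass_invariant_prob R d k sigma ->
  forall alpha : 'I_d -> nat, (\sum_(i < d) alpha i)%N = t ->
  exists m : nat, (1 <= m)%N /\
  exists (y : 'I_t -> 'I_m -> 'cV[R]_d) (f : 'I_t -> 'I_m -> R),
    (forall s i, on_sphere R d (y s i)) /\
    forall x : 'cV[R]_d, on_sphere R d x ->
      monomial R d alpha x =
      \sum_(s < t) \sum_(i < m) f s i * mu_moment R d k sigma s.+1 (Exy R d x (y s i)).
Proof.
move=> k_gt0 k_lt_d; case: t => // t _ sigmaP alpha sum_alpha.
have d_gt0 : (0 < d)%N := leq_ltn_trans (leq0n k) k_lt_d.
(* A point of the sphere, so that the set to be spanned is nonempty. *)
pose e1 : 'cV[R]_d := delta_mx (Ordinal d_gt0) 0.
have e1S : on_sphere R d e1.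
  by apply/on_sphereE; rewrite trmx_delta mul_delta_mx mxE !eqxx.
set Q := @tpow_mean R d k t.+1 sigma.
have [m [M MA spanM]] := finite_row_span
  [set a | exists2 y, on_sphere R d y & a = (tpow_vec t.+1 y)^T]%classic _
  (ex_intro2 _ _ e1 e1S erefl).
have /choice [y yP] :
    forall i, exists y, on_sphere R d y /\ row i M = (tpow_vec t.+1 y)^T.
  by move=> i; have [y yS yE] := MA i; exists y.
have [i0 monoE] := @monomial_tpow_vec R _ _ _ sum_alpha.
have Mgram : (M^T <= M *m Q *m M^T)%MS.
  apply: mulmx_gram_sub => u Ku; apply: sqnorm_eq0.
  have nv := tpow_mean_null t.+1 sigmaP (M^T *m u).
  suff Mv : M *m (M^T *m u) = 0.
    by rewrite trmx_mul trmxK -mulmxA Mv mulmx0 mxE.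
  apply/row_matrixP => i; rewrite row_mul row0 (yP i).2.
  apply: (ae_null_dot t.+1 sigmaP k_gt0) (yP i).1; apply: nv.
  (* With v = M^T u, [Ku] reads M Q v = 0; multiplying by u^T on the left gives v^T Q v = 0. *)
  by move: Ku; rewrite trmx_mul trmxK -!mulmxA => ->; rewrite mulmx0 mxE.
(* Row [i0] of [M^T] holds the [i0]-th coordinates of the chosen tensors; its coordinates [f] in the
   rows of the Gram matrix are the required coefficients. *)
have /submxP[f fE] : (row i0 M^T <= M *m Q *m M^T)%MS.
  by apply: submx_trans Mgram; exact: row_sub.
exists m.+1; split=> //; exists (fun _ i => y i).
(* The index [s] starts at 0 and stands for exponent [s.+1], so [ord_max] selects the top moment. *)
exists (fun s i => if s == ord_max then f 0 i else 0); split=> [s i|x xS].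
  exact: (yP i).1.
have /submxP[c cE] : ((tpow_vec t.+1 x)^T <= M)%MS by apply: spanM; exists x.
rewrite (bigD1 ord_max) //= [X in _ + X]big1 ?addr0; last first.
  by move=> s /negbTE ->; rewrite big1 // => i _; rewrite mul0r.
have xE : tpow_vec t.+1 x = M^T *m c^T by rewrite -trmx_mul -cE trmxK.
(* As the tensor power of [x] is M^T c^T, the product becomes f (M Q M^T) c^T, which is row [i0] of
   [M^T] times c^T: the [i0]-th coordinate. *)
have rowE : (f *m M *m Q *m tpow_vec t.+1 x) 0 0 = monomial R d alpha x.
  rewrite xE -!mulmxA (mulmxA Q) (mulmxA M) (mulmxA M) (mulmxA f) -fE.
  by rewrite -row_mul -xE mxE monoE.
rewrite -rowE -!mulmxA mxE; apply: eq_bigr => i _.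
rewrite eqxx mu_momentE //; congr (_ * _).
by rewrite -(yP i).2 -!row_mul -!mulmxA [RHS]mxE.
Qed.
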